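(* Let $s\ge1$. Let the dihedral group $D_{2s}$, generated by the group $\mu_s\subset\mathbb{K}^*$ of $s$-th roots of unity and an involution $r$, act on $\mathbb{A}^{s-1}=\mathbb{K}^{s-1}$ with coordinates $(b_1,\dots,b_{s-1})$ by $\zeta\cdot(b_1,\dots,b_{s-1})=(\zeta b_1,\zeta^2b_2,\dots,\zeta^{s-1}b_{s-1})$ for $\zeta\in\mu_s$ and $r\cdot(b_1,\dots,b_{s-1})=(b_{s-1},b_{s-2},\dots,b_1)$. For $b\in\mathbb{K}^{s-1}$ put $f_b(y):=y^s+b_{s-1}y^{s-1}+\cdots+b_1y+1$. Then the assignment $b\mapsto[A_{f_b}]$ induces a bijection between the set of $D_{2s}$-orbits in $\mathbb{K}^{s-1}$ (the points of the quotient $\mathbb{A}^{s-1}/D_{2s}$) and the set of isomorphism classes of $\mathbb{K}$-algebras $A_f$, where $f$ ranges over all polynomials in $\mathbb{K}[y]$ of degree $s$ with nonzero constant term. Hence the coarse moduli space of detropicalizations of $\mathcal M_s$ is $\mathbb{A}^{s-1}/D_{2s}$.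
   Context: $\mathbb{K}$ is an algebraically closed field of characteristic $0$. For $h\in\mathbb{K}[y]$ with nonzero constant term, $A_h:=\mathbb{K}[x_1,x_2,y^{\pm1}]/(x_1x_2-h(y))$. The detropicalizations of the rank-two shearing polyptych lattice $\mathcal M_s$ are (up to isomorphism) exactly the algebras $A_h$ with $\deg h=s$ and $h(0)\neq0$, and the coarse moduli space of detropicalizations is the set of their isomorphism classes. *)

(* Defs.v *)
From HB Require Import structures.
From mathcomp Require Import all_boot all_order all_algebra.
From mathcomp Require Import ring_quotient generic_quotient.
From mathcomp.multinomials Require Import mpoly.
From Stdlib Require Import ClassicalEpsilon Relation_Operators.

Set Implicit Arguments.
Unset Strict Implicit.
Unset Printing Implicit Defensive.

Import GRing.Theory.
Local Open Scope quotient_scope.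
Local Open Scope ring_scope.

Section Detrop.
Variable K : fieldType.

(* Ambient polynomial ring K[x1, x2, y, z]; z plays the role of y^{-1}. *)
Local Notation PR := {mpoly K[4]}.
Definition vx1 : 'I_4 := @Ordinal 4 0 isT.
Definition vx2 : 'I_4 := @Ordinal 4 1 isT.
Definition vy  : 'I_4 := @Ordinal 4 2 isT.
Definition vz  : 'I_4 := @Ordinal 4 3 isT.

Definition hY (h : {poly K}) : PR := (map_poly (@mpolyC 4 K) h).['X_vy].

Definition gen1 (h : {poly K}) : PR := 'X_vx1 * 'X_vx2 - hY h.
Definition gen2 : PR := 'X_vy * 'X_vz - 1.

Definition Ih (h : {poly K}) : {pred PR} := fun p =>
  if excluded_middle_informative
       (exists a b : PR, p = a * gen1 h + b * gen2) then true else false.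

Lemma IhP h p : reflect (exists a b : PR, p = a * gen1 h + b * gen2) (p \in Ih h).
Proof.
rewrite unfold_in /Ih.
by case: excluded_middle_informative => H; constructor.
Qed.

Lemma hY_eval h (v : 'I_4 -> K) : (hY h).@[v] = h.[v vy].
Proof.
rewrite /hY -horner_map /= mevalXU; congr (_.[_]).
rewrite -map_poly_comp; apply: map_poly_id => c _ /=; exact: mevalC.
Qed.

Lemma Ih_ideal h : @idealr_closed PR (Ih h).
Proof.
split.
- by apply/IhP; exists 0, 0; rewrite !mul0r addr0.
- apply/negP => /IhP [a [b E]].
  pose v : 'I_4 -> K := fun i => if i == vx1 then h.[1] else 1.
  have := congr1 (meval v) E.
  rewrite mevalC mevalD !mevalM /gen1 mevalB mevalM !mevalXU hY_eval.
  rewrite /gen2 mevalB mevalM !mevalXU meval1 /v /=.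
  by rewrite mulr1 subrr mulr0 mulr1 subrr mulr0 addr0 => /eqP; rewrite oner_eq0.
- move=> a p q /IhP [c [d ->]] /IhP [e [f ->]]; apply/IhP.
  exists (a * c + e), (a * d + f).
  by rewrite mulrDr !mulrA !mulrDl addrACA.
Qed.

HB.instance Definition _ h := isIdealr.Build PR (Ih h) (Ih_ideal h).

(* A_h := K[x1, x2, y^{+-1}] / (x1 x2 - h(y))
        = K[x1, x2, y, z] / (x1 x2 - h(y), y z - 1). *)
Definition A (h : {poly K}) := {ideal_quot (Ih h)}.

Definition Kc (h : {poly K}) (c : K) : A h := \pi_(A h) (c%:MP : PR).

Definition AlgIso (h g : {poly K}) : Prop :=
  exists phi : {rmorphism A h -> A g},
    bijective phi /\ forall c : K, phi (Kc h c) = Kc g c.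

(* f_b(y) = y^s + b_{s-1} y^{s-1} + ... + b_1 y + 1, where b = (b_1,...,b_{s-1})
   is stored as a row vector with b_(i+1) at index i. *)
Definition fb (s : nat) (b : 'rV[K]_(s.-1)) : {poly K} :=
  'X^s + \sum_(i < s.-1) b 0 i *: 'X^(i.+1) + 1.

Definition act_mu (s : nat) (zeta : K) (b : 'rV[K]_(s.-1)) : 'rV[K]_(s.-1) :=
  \row_(i < s.-1) (zeta ^+ i.+1 * b 0 i).

Definition act_r (s : nat) (b : 'rV[K]_(s.-1)) : 'rV[K]_(s.-1) :=
  \row_(i < s.-1) b 0 (rev_ord i).

Definition dihedral_step (s : nat) (b b' : 'rV[K]_(s.-1)) : Prop :=
  (exists zeta : K, zeta ^+ s = 1 /\ b' = act_mu zeta b) \/ b' = act_r b.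

Definition same_orbit (s : nat) : 'rV[K]_(s.-1) -> 'rV[K]_(s.-1) -> Prop :=
  clos_refl_trans _ (@dihedral_step s).

End Detrop.

(* Main.v *)
(* A_g embeds in K(y)[t, 1/t] by x1 |-> t, x2 |-> g(y)/t; the coefficient of t^-n
   in the image is divisible by g^n, so the units of A_g are the c y^k. An isomorphism
   A_h -> A_g therefore sends y to c y or c/y, and x1, x2 to elements whose product
   is h(c y) or h(c/y); factors of an element of K[y, 1/y] are monomials in t, and t
   must occur, so g divides that element. Equality of degrees then fixes h in terms
   of g up to the dihedral action. *)
Require Import Defs.
From HB Require Import structures.
From mathcomp Require Import all_boot all_order all_algebra.
From mathcomp Require Import ring_quotient generic_quotient fraction.
From mathcomp.multinomials Require Import mpoly.
From Stdlib Require Import Relation_Operators.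
From mathcomp Require Import ring zify.

Import GRing.Theory.
Local Open Scope ring_scope.
Set Implicit Arguments.
Unset Strict Implicit.
Unset Printing Implicit Defensive.

(** * The quotient map onto [A h] and its kernel *)

Section Presentation.
Variable K : fieldType.
Implicit Types h g : {poly K}.

Local Notation PR := {mpoly K[4]}.

Definition piA h : PR -> A h := \pi_(A h)%qT.

Lemma piA_zmod_morphism h : zmod_morphism (piA h).
Proof.
move=> p q.
exact: (@pi_is_zmod_morphism _ _ _ (Quotient.quot (Ih h))).
Qed.

HB.instance Definition _ h :=
  GRing.isZmodMorphism.Build PR (A h) (piA h) (piA_zmod_morphism h).

Lemma piA_monoid_morphism h : monoid_morphism (piA h).
Proof.
exact: (@pi_is_monoid_morphism _ _ _ (Quotient.quot (Ih h))).
Qed.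

HB.instance Definition _ h :=
  GRing.isMonoidMorphism.Build PR (A h) (piA h) (piA_monoid_morphism h).

Lemma piA_ker h (p : PR) :
  piA h p = 0 <-> exists a b : PR, p = a * gen1 h + b * gen2 K.
Proof.
rewrite -(rmorph0 (piA h)); split.
  move=> /eqP; rewrite eqmodE /= Quotient.equivE subr0.
  by move/IhP.
move=> H; apply/eqP; rewrite eqmodE /= Quotient.equivE subr0.
exact/IhP.
Qed.
End Presentation.

(** * Generators, induction principle and universal property of [A h] *)

Section Lift.
Variable K : fieldType.
Implicit Types h g : {poly K}.

(** The same function as [Kc h], written as a composite of morphisms so that its ring morphism
    structure is inferred. *)
Definition kA h : K -> A h := piA h \o @mpolyC 4 K.
HB.instance Definition _ h := GRing.RMorphism.on (@kA h).

Lemma piA_repr h (a : A h) : piA h (repr a) = a.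
Proof. by rewrite /piA reprK. Qed.

Definition x1 h : A h := piA h 'X_(vx1).
Definition x2 h : A h := piA h 'X_(vx2).
Definition yA h : A h := piA h 'X_(vy).
Definition zA h : A h := piA h 'X_(vz).

Lemma yzA h : yA h * zA h = 1.
Proof.
apply/eqP; rewrite -subr_eq0; apply/eqP; rewrite -rmorphM -(rmorph1 (piA h)) -rmorphB.
by apply/piA_ker; exists 0, 1; rewrite mul0r add0r mul1r.
Qed.

Lemma x1x2A h : x1 h * x2 h = (map_poly (@kA h) h).[yA h].
Proof.
rewrite /kA map_poly_comp horner_map -rmorphM.
apply/eqP; rewrite -subr_eq0; apply/eqP; rewrite -rmorphB.
by apply/piA_ker; exists 1, 0; rewrite mul0r addr0 mul1r.
Qed.

(** Induction on a polynomial representative, monomial by monomial; [0] and [1] are covered as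
    constants. *)
Lemma A_ind h (S : A h -> Prop) :
  (forall c, S (kA h c)) -> S (x1 h) -> S (x2 h) -> S (yA h) -> S (zA h) ->
  (forall a b, S a -> S b -> S (a + b)) ->
  (forall a b, S a -> S b -> S (a * b)) -> forall a, S a.
Proof.
move=> SC S1 S2 Sy Sz SD SM a.
rewrite -[a]piA_repr; elim/mpolyind: (repr a) => [|c m p _ _ IH].
  by rewrite rmorph0 -(rmorph0 (@kA h)); exact: SC.
rewrite rmorphD; apply: (SD) => //.
rewrite -mul_mpolyC rmorphM; apply: (SM); first exact: (SC c).
have S1' : S 1 by rewrite -(rmorph1 (@kA h)); exact: SC.
rewrite mpolyXE_id rmorph_prod; apply: big_ind => // i _.
rewrite rmorphXn.
have SX : S (piA h (mpolyX _ U_(i))).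
  case: i => [[|[|[|[|//]]]] Hi].
  - by rewrite (_ : Ordinal Hi = vx1) //; apply/val_inj.
  - by rewrite (_ : Ordinal Hi = vx2) //; apply/val_inj.
  - by rewrite (_ : Ordinal Hi = vy) //; apply/val_inj.
  - by rewrite (_ : Ordinal Hi = vz) //; apply/val_inj.
by elim: (m i) => [|n IHn]; rewrite ?expr0 // exprS; apply: (SM).
Qed.

(** Universal property: a solution of both defining relations in [R] yields a morphism, namely
    evaluation of a representative. *)
Lemma A_lift h (R : comNzRingType) (k : {rmorphism K -> R}) (a b y z : R) :
  a * b = (map_poly k h).[y] -> y * z = 1 ->
  exists phi : {rmorphism A h -> R},
    [/\ forall c, phi (kA h c) = k c, phi (x1 h) = a, phi (x2 h) = b,
        phi (yA h) = y & phi (zA h) = z].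
Proof.
move=> Hab Hyz; pose v (i : 'I_4) := nth 0 [:: a; b; y; z] i.
(* Both generators of the ideal evaluate to [0] at [v], so the value depends only on the class of
   the representative. *)
have Hv p : piA h p = 0 -> mmap k v p = 0.
  move=> /piA_ker [c [d ->]]; rewrite rmorphD !rmorphM /gen1 /gen2 !rmorphB !rmorphM.
  rewrite rmorph1 /= !mmapX !mmap1U /v /= Hyz subrr mulr0 addr0 Hab /hY.
  rewrite -horner_map /= mmapX mmap1U -map_poly_comp /=.
  rewrite (eq_map_poly (g := k)) ?subrr ?mulr0 // => e /=.
  by rewrite mmapC.
pose f (q : A h) := mmap k v (repr q).
have fE p : f (piA h p) = mmap k v p.
  apply/eqP; rewrite -subr_eq0 -rmorphB; apply/eqP/Hv.
  by rewrite rmorphB /= piA_repr subrr.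
have fB : zmod_morphism f.
  by move=> p q; rewrite -[p]piA_repr -[q]piA_repr -rmorphB !fE rmorphB.
have fM : monoid_morphism f.
  split; first by rewrite -(rmorph1 (piA h)) fE rmorph1.
  by move=> p q; rewrite -[p]piA_repr -[q]piA_repr -rmorphM !fE rmorphM.
pose f1 := GRing.isZmodMorphism.Build (A h) R f fB.
pose f2 := GRing.isMonoidMorphism.Build (A h) R f fM.
pose phi : {rmorphism A h -> R} := HB.pack f f1 f2.
exists phi; split=> [c||||]; rewrite [LHS]fE ?mmapX ?mmap1U //.
by rewrite mmapC.
Qed.
End Lift.

(** * Evaluation of polynomials in one and two variables *)

Lemma horner_map_wide (R S : nzRingType) (f : {rmorphism R -> S})
    (p : {poly R}) x n :
  (size p <= n)%N -> (map_poly f p).[x] = \sum_(i < n) f p`_i * x ^+ i.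
Proof.
move=> le_pn; rewrite (@horner_coef_wide _ n).
  by apply: eq_bigr => i _; rewrite coef_map.
exact: leq_trans (size_poly _ _) le_pn.
Qed.

Lemma poly_split (R : nzRingType) (P : {poly R}) :
  exists Q c, P = Q * 'X + c%:P.
Proof.
elim/poly_ind: P => [|Q c _]; last by exists Q, c.
by exists 0, 0; rewrite mul0r addr0.
Qed.

Section Evaluation.
Variables (K : fieldType) (R : comNzRingType) (k : {rmorphism K -> R}) (y x : R).

Definition ev1 : {poly K} -> R := horner_eval y \o map_poly k.
HB.instance Definition _ := GRing.RMorphism.on ev1.

Definition ev2 : {poly {poly K}} -> R := horner_eval x \o map_poly ev1.
HB.instance Definition _ := GRing.RMorphism.on ev2.

Lemma ev1C c : ev1 c%:P = k c.
Proof. by rewrite /ev1 /= map_polyC /horner_eval hornerC. Qed.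

Lemma ev1X : ev1 'X = y.
Proof. by rewrite /ev1 /= map_polyX /horner_eval hornerX. Qed.

Lemma ev2C p : ev2 p%:P = ev1 p.
Proof. by rewrite /ev2 /= map_polyC /horner_eval hornerC. Qed.

Lemma ev2X : ev2 'X = x.
Proof. by rewrite /ev2 /= map_polyX /horner_eval hornerX. Qed.

Lemma ev1E n (p : {poly K}) : (size p <= n)%N -> ev1 p = \sum_(i < n) k p`_i * y ^+ i.
Proof. exact: horner_map_wide. Qed.

Lemma ev2E n (P : {poly {poly K}}) :
  (size P <= n)%N -> ev2 P = \sum_(i < n) ev1 P`_i * x ^+ i.
Proof. exact: horner_map_wide. Qed.

Definition evE := (ev2C, ev2X, ev1C, ev1X).
End Evaluation.

Lemma rmorph_ev1 (K : fieldType) (R S : comNzRingType) (k : {rmorphism K -> R})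
    (k' : {rmorphism K -> S}) (phi : {rmorphism R -> S}) (y : R) p :
  (forall c, phi (k c) = k' c) -> phi (ev1 k y p) = ev1 k' (phi y) p.
Proof.
move=> phik; rewrite /ev1 /= /horner_eval -horner_map -map_poly_comp.
by rewrite (eq_map_poly (g := k')).
Qed.

Lemma rmorph_ev2 (K : fieldType) (R S : comNzRingType) (k : {rmorphism K -> R})
    (k' : {rmorphism K -> S}) (phi : {rmorphism R -> S}) (y x : R) P :
  (forall c, phi (k c) = k' c) ->
  phi (ev2 k y x P) = ev2 k' (phi y) (phi x) P.
Proof.
move=> phik; rewrite /ev2 /= /horner_eval -horner_map -map_poly_comp.
rewrite (eq_map_poly (g := ev1 k' (phi y))) // => p /=.
exact: rmorph_ev1.
Qed.

(** A power of [y] clears [z], and [x1 x2 = g(y)] removes mixed monomials. The extra factor [x2]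
    keeps the second summand free of terms in [y] alone, so the two summands use different
    monomials. *)
Lemma A_span (K : fieldType) (g : {poly K}) (a : A g) : exists N P Q,
  yA g ^+ N * a = ev2 (@kA _ g) (yA g) (x1 g) P
                  + x2 g * ev2 (@kA _ g) (yA g) (x2 g) Q.
Proof.
pose span a := exists N P Q,
  yA g ^+ N * a = ev2 (@kA _ g) (yA g) (x1 g) P
                  + x2 g * ev2 (@kA _ g) (yA g) (x2 g) Q.
(* Stability under multiplication by every [a] reduces to the generators, since the case of a
   product is a composition. *)
suff span_mul b : span b -> span (a * b).
  rewrite -[a]mulr1; apply: span_mul; exists 0, 1, 0.
  by rewrite !(rmorph0, rmorph1) !mulr0 addr0 mulr1.
elim/A_ind: a b => [c|||||a1 a2 IH1 IH2|a1 a2 IH1 IH2] b.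
- move=> [N [P [Q E]]]; exists N, (c%:P%:P * P), (c%:P%:P * Q).
  by rewrite mulrCA E !rmorphM /= !evE; ring.
(* Multiplication by [x1] turns [x2 Q(x2)] into [g Q(x2)], whose constant term in [x2] moves to the
   first summand. *)
- move=> [N [P [Q E]]]; have [Q' [q EQ]] := poly_split Q.
  exists N, (P * 'X + (g * q)%:P), (g%:P * Q').
  rewrite mulrCA E EQ !rmorphD /= !rmorphM /= !evE.
  by rewrite [ev1 _ _ g](esym (x1x2A g)); ring.
- move=> [N [P [Q E]]]; have [P' [p EP]] := poly_split P.
  exists N, (g%:P * P'), (Q * 'X + p%:P).
  rewrite mulrCA E EP !rmorphD /= !rmorphM /= !evE.
  by rewrite [ev1 _ _ g](esym (x1x2A g)); ring.
- move=> [N [P [Q E]]]; exists N, ('X%:P * P), ('X%:P * Q).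
  by rewrite mulrCA E !rmorphM /= !evE; ring.
- move=> [N [P [Q E]]]; exists N.+1, P, Q.
  by rewrite -E exprSr -mulrA [yA g * _]mulrA yzA mul1r.
- move=> Hb; have [N [P [Q E]]] := IH1 b Hb; have [M [P' [Q' E']]] := IH2 b Hb.
  exists (N + M)%N, ('X^M%:P * P + 'X^N%:P * P'), ('X^M%:P * Q + 'X^N%:P * Q').
  transitivity (yA g ^+ M * (yA g ^+ N * (a1 * b)) + yA g ^+ N * (yA g ^+ M * (a2 * b))).
    by rewrite exprD; ring.
  rewrite E E' !rmorphD /= !rmorphM /= !evE !rmorphXn /= !evE.
  ring.
- by move=> /IH2/IH1; rewrite mulrA.
Qed.

(** * Factors of monomials, and divisibility by powers of [g] *)

Lemma polyXn_split (R : idomainType) (P : {poly R}) :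
  P != 0 -> exists i P0, P = P0 * 'X^i /\ P0`_0 != 0.
Proof.
move=> P0; have [i [Q]] := multiplicity_XsubC P 0.
rewrite P0 subr0 /= /root horner_coef0 => Q0 EP.
by exists i, Q.
Qed.

(** Once the largest powers of ['X] are removed, both cofactors have a nonzero constant term, and so
    has their product. This fixes the exponent, and over a domain the factors of a nonzero constant
    are constants. *)
Lemma mul_eq_monomial (R : idomainType) (P Q : {poly R}) r n :
  r != 0 -> P * Q = r%:P * 'X^n ->
  exists p q i j,
    [/\ P = p%:P * 'X^i, Q = q%:P * 'X^j, p * q = r & (i + j)%N = n].
Proof.
move=> r0 PQ.
have /norP[/polyXn_split[i [P0 [EP P00]]] /polyXn_split[j [Q0 [EQ Q00]]]] :
    ~~ ((P == 0) || (Q == 0)).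
  by rewrite -mulf_eq0 PQ mulf_neq0 ?polyC_eq0 ?expf_neq0 ?polyX_eq0.
have PQ' : P0 * Q0 * 'X^(i + j) = r%:P * 'X^n by rewrite -PQ EP EQ exprD; ring.
have Hn : (i + j)%N = n.
  have := congr1 (fun S : {poly R} => S`_(i + j)) PQ'.
  rewrite coefMXn ltnn subnn coefCM coefXn coef0M.
  case: (_ =P n) => //= _; move/eqP; rewrite mulr0 mulf_eq0 (negbTE P00) (negbTE Q00) //.
have {}PQ' : P0 * Q0 = r%:P.
  by move: PQ'; rewrite Hn; apply: mulIf; rewrite expf_neq0 ?polyX_eq0.
have nzP : P0 != 0 by apply: contraNneq P00 => ->; rewrite coef0.
have nzQ : Q0 != 0 by apply: contraNneq Q00 => ->; rewrite coef0.
have sz : (size P0 <= 1)%N /\ (size Q0 <= 1)%N.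
  have := size_mul nzP nzQ; rewrite PQ' size_polyC r0 /=.
  move: nzP nzQ; rewrite -!size_poly_gt0.
  by move: (size P0) (size Q0) => a b; lia.
case: sz => /size1_polyC E0 /size1_polyC E1.
exists P0`_0, Q0`_0, i, j; split=> //; try by rewrite -?E0 -?E1.
by apply/polyC_inj; rewrite -PQ' E0 E1 polyCM !coefC.
Qed.

Section Divisibility.
Variable K : fieldType.
Implicit Types (g p r : {poly K}) (P Q : {poly {poly K}}).

(* P t^-N lies in the image of A_g in K[y^+-1][t^+-1], where x1 = t and x2 = g/t;
   the truncated exponent N - j leaves the coefficients with j >= N free. *)
Definition adapted g N P := forall j, g ^+ (N - j) %| P`_j.

Lemma adapted_mulC g N p P : adapted g N P -> adapted g N (p%:P * P).
Proof. by move=> aP j; rewrite coefCM dvdp_mull. Qed.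

(** Both factors are monomials. Unless their exponents are exactly [N] and [M], one of them lies
    strictly below its threshold, and its coefficient carries a factor [g]. *)
Lemma adapted_mul_monomial g N M P Q r :
  adapted g N P -> adapted g M Q -> r != 0 -> P * Q = r%:P * 'X^(N + M) ->
  (exists p, P = p%:P * 'X^N) \/ g %| r.
Proof.
move=> aP aQ r0 /(mul_eq_monomial r0)[p [q [i [j [EP EQ Er Eij]]]]].
have dvd_coef n (S : {poly {poly K}}) m s :
    adapted g n S -> S = s%:P * 'X^m -> (m < n)%N -> g %| s.
  move=> aS ES lt_mn; have := aS m; rewrite ES coefCM coefXn eqxx mulr1.
  by apply: dvdp_trans; rewrite -{1}(expr1 g) dvdp_exp2l // subn_gt0.
have [lt_iN|lt_Ni|eq_iN] := ltngtP i N.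
- by right; rewrite -Er dvdp_mulr // (dvd_coef N P i).
- by right; rewrite -Er dvdp_mull // (dvd_coef M Q j) //; lia.
- by left; exists p; rewrite EP eq_iN.
Qed.

(** A nonzero constant term makes [g] coprime to ['X]. Powers of [y] introduced to clear
    denominators are thus harmless. *)
Lemma dvdp_mulXn g n r : g`_0 != 0 -> (g %| 'X^n * r) = (g %| r).
Proof.
move=> g0; rewrite Gauss_dvdpr // coprimep_expr // -['X]subr0.
by rewrite coprimep_XsubC /root horner_coef0.
Qed.
End Divisibility.

(** * The embedding of [A g] in the fraction field of [K[y][t]], and the units of [A g] *)

Section Embedding.
Variables (K : fieldType).
Implicit Types (g : {poly K}).

Local Notation F := {fraction {poly {poly K}}}.

Definition kF : K -> F := @tofrac _ \o polyC \o polyC.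
HB.instance Definition _ := GRing.RMorphism.on kF.

Definition YF : F := tofrac 'X%:P.
Definition TF : F := tofrac 'X.

Lemma YF_neq0 : YF != 0.
Proof. by rewrite tofrac_eq0 polyC_eq0 polyX_eq0. Qed.

Lemma TF_neq0 : TF != 0.
Proof. by rewrite tofrac_eq0 polyX_eq0. Qed.

Lemma ev1F p : ev1 kF YF p = tofrac p%:P.
Proof.
elim/poly_ind: p => [|p c IH]; first by rewrite !rmorph0.
by rewrite !(rmorphD, rmorphM) /= IH !evE.
Qed.

Lemma ev2F P : ev2 kF YF TF P = tofrac P.
Proof.
elim/poly_ind: P => [|P p IH]; first by rewrite !rmorph0.
by rewrite !(rmorphD, rmorphM) /= IH !evE ev1F.
Qed.

(** The image of [x2] is then [g / t]. The choice [t = TF] gives the embedding; comparing it with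
    [t = TF^2] later shows that [x1] is independent of [y]. *)
Lemma A_torus_point g (t : F) : t != 0 ->
  exists chi : {rmorphism A g -> F},
    [/\ forall c, chi (kA g c) = kF c, chi (yA g) = YF & chi (x1 g) = t].
Proof.
move=> nzt; have [||chi [Ec E1 _ Ey _]] :=
  @A_lift K g F kF t ((map_poly kF g).[YF] / t) YF YF^-1.
- by rewrite mulrC divfK.
- by rewrite divff ?YF_neq0.
by exists chi.
Qed.

Definition embedding g (iota : {rmorphism A g -> F}) :=
  [/\ forall c, iota (kA g c) = kF c, iota (yA g) = YF & iota (x1 g) = TF].

Lemma embedding_exists g : exists iota : {rmorphism A g -> F}, embedding iota.
Proof. exact: (A_torus_point g TF_neq0). Qed.

(** Read off from the spanning form: the part in [x1] only produces exponents at least [m], where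
    [adapted] asks nothing, and the part in [x2] brings its own powers of [g]. The last clause
    yields injectivity. *)
Lemma A_image g (iota : {rmorphism A g -> F}) a :
  g != 0 -> embedding iota ->
  exists N m P, [/\ adapted g m P, YF ^+ N * TF ^+ m * iota a = tofrac P
                  & P = 0 -> a = 0].
Proof.
move=> nzg [Ec Ey E1]; have [N [P [Q E]]] := A_span a.
have E2 : TF * iota (x2 g) = tofrac g%:P.
  by rewrite -E1 -rmorphM x1x2A -ev1F -Ey; apply: rmorph_ev1.
pose m := size Q.
(* After multiplication by [TF^m], the term [Q_i x2^(i+1)] becomes [Q_i g^(i+1) TF^(m-i-1)]; the
   index is [j = m-i-1]. *)
pose Q' := \poly_(j < m) (Q`_(m - j.+1) * g ^+ (m - j)).
have EQ' : TF ^+ m * iota (x2 g * ev2 (@kA _ g) (yA g) (x2 g) Q) = tofrac Q'.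
  rewrite rmorphM /= (rmorph_ev2 _ _ _ Ec) Ey (ev2E _ _ _ (leqnn m)) /Q' poly_def.
  rewrite rmorph_sum mulrA mulr_sumr (reindex_inj rev_ord_inj).
  apply: eq_bigr => /= i _; have lt_im := ltn_ord i.
  rewrite -mul_polyC !rmorphM /= !rmorphXn /= -/TF -E2 ev1F.
  have -> : TF ^+ m = TF ^+ i * TF * TF ^+ (m - i.+1).
    by rewrite -exprSr -exprD subnKC.
  have -> : (m - i = (m - i.+1).+1)%N by rewrite -subSn // subSS.
  by rewrite !exprS exprMn; ring.
exists N, m, (P * 'X^m + Q'); split.
- move=> j; rewrite coefD coefMXn coef_poly; case: ltnP => [lt_jm|le_mj].
    by rewrite add0r dvdp_mull.
  by rewrite (eqP le_mj) dvd1p.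
- have EP : iota (ev2 (@kA _ g) (yA g) (x1 g) P) = tofrac P.
    by rewrite (rmorph_ev2 _ _ _ Ec) Ey E1 ev2F.
  rewrite rmorphD /= -EQ' rmorphM /= rmorphXn /= -/TF -EP.
  transitivity (TF ^+ m * iota (yA g ^+ N * a)).
    by rewrite rmorphM rmorphXn /= Ey; ring.
  by rewrite E rmorphD /=; ring.
(* The two summands occupy the exponents from [m] on and those below [m], so no cancellation occurs
   between them. *)
- move=> P0; have Pj j : P`_j = 0.
    have := congr1 (fun S : {poly {poly K}} => S`_(j + m)) P0.
    by rewrite coefD coefMXn coef_poly coef0 !ltnNge leq_addl /= addnK addr0.
  have Qj j : Q`_j = 0.
    have [lt_jm|/(nth_default 0)//] := ltnP j m.
    have := congr1 (fun S : {poly {poly K}} => S`_(m - j.+1)) P0.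
    have lt_mj : (m - j.+1 < m)%N by lia.
    rewrite coefD coefMXn coef_poly coef0 lt_mj add0r.
    have -> : (m - (m - j.+1).+1)%N = j by lia.
    by move=> /eqP; rewrite mulf_eq0 expf_eq0 (negbTE nzg) andbF orbF => /eqP.
  have {}P0 : P = 0 by apply/polyP => j; rewrite Pj coef0.
  have Q0 : Q = 0 by apply/polyP => j; rewrite Qj coef0.
  have /(congr1 (fun u => zA g ^+ N * u)) := E.
  rewrite P0 Q0 !rmorph0 mulr0 addr0 mulr0 mulrA -exprMn.
  by rewrite [zA g * _]mulrC yzA expr1n mul1r.
Qed.

Lemma embedding_inj g (iota : {rmorphism A g -> F}) :
  g != 0 -> embedding iota -> injective iota.
Proof.
move=> nzg Hi a b /eqP; rewrite -subr_eq0 -rmorphB => /eqP Eab.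
apply/eqP; rewrite -subr_eq0; have [N [m [P [_ EP ->//]]]] := A_image (a - b) nzg Hi.
by apply/eqP; rewrite -tofrac_eq0 -EP Eab mulr0.
Qed.

(* The powers of y are the only units up to scalars because g is not a unit
   of K[y^+-1]. *)
Lemma A_unit g (u v : A g) :
  (1 < size g)%N -> g`_0 != 0 -> u * v = 1 ->
  exists N i c, c != 0 /\ yA g ^+ N * u = kA g c * yA g ^+ i.
Proof.
move=> sg g0 uv; have nzg : g != 0 by rewrite -size_poly_gt0 ltnW.
have [iota Hi] := embedding_exists g.
have [N [n [P [aP EP _]]]] := A_image u nzg Hi.
have [M [m [Q [aQ EQ _]]]] := A_image v nzg Hi.
have PQ : P * Q = ('X^(N + M))%:P * 'X^(n + m).
  apply/eqP; rewrite -tofrac_eq rmorphM /= -EP -EQ mulrACA -rmorphM uv rmorph1.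
  apply/eqP; rewrite rmorphM !rmorphXn /= !exprD -/TF; rewrite -/YF; ring.
have nzX : 'X^(N + M) != 0 :> {poly K} by rewrite expf_neq0 ?polyX_eq0.
have [[p Ep]|] := adapted_mul_monomial aP aQ nzX PQ; last first.
  rewrite -[X in _ %| X]mulr1 dvdp_mulXn // dvdp1 => /eqP sg1.
  by rewrite sg1 in sg.
(* The coefficient of degree [n + m] shows that [p] divides a power of the inner variable, hence is
   itself a monomial [c y^i]. *)
have pQ : p * Q`_m = 1%:P * 'X^(N + M).
  have := congr1 (fun S : {poly {poly K}} => S`_(n + m)) PQ.
  rewrite mul1r Ep -mulrA !coefCM coefXnM coefXn eqxx mulr1.
  by rewrite ltnNge leq_addr /= addKn.
have [c [d [i [_ [Ec _ cd _]]]]] := mul_eq_monomial (oner_neq0 _) pQ.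
exists N, i, c; split.
  by apply/eqP => c0; move/eqP: cd; rewrite c0 mul0r eq_sym oner_eq0.
apply: (embedding_inj nzg Hi); apply: (mulIf (expf_neq0 n TF_neq0)).
have [Eiota Ey _] := Hi; rewrite !rmorphM !rmorphXn /= Eiota Ey mulrAC EP Ep Ec.
by rewrite !rmorphM /= !rmorphXn.
Qed.
End Embedding.

(** * Rescaling and reversing coefficients as substitutions *)

Section Substitution.
Variables (K : fieldType) (R : comNzRingType) (k : {rmorphism K -> R}).
Implicit Types p q : {poly K}.

Lemma ev1_scale (y : R) a l p q :
  (forall i, q`_i = a * l ^+ i * p`_i) -> ev1 k y q = k a * ev1 k (k l * y) p.
Proof.
move=> Eq; pose n := maxn (size p) (size q).
rewrite (ev1E _ _ (leq_maxl _ _ : size p <= n)%N).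
rewrite (ev1E _ _ (leq_maxr _ _ : size q <= n)%N) mulr_sumr.
apply: eq_bigr => i _; rewrite Eq !rmorphM rmorphXn exprMn /=.
ring.
Qed.

(** Termwise this is [y^(n-i) = y^n z^i], with [z] the inverse of [y]. *)
Lemma ev1_flip (y z : R) n l p q :
  y * z = 1 -> (size p <= n.+1)%N -> (size q <= n.+1)%N ->
  (forall i, (i <= n)%N -> q`_(n - i) = l ^+ i * p`_i) ->
  ev1 k y q = y ^+ n * ev1 k (k l * z) p.
Proof.
move=> yz sp sq Eq; rewrite (ev1E _ _ sp) (ev1E _ _ sq) mulr_sumr.
rewrite (reindex_inj rev_ord_inj); apply: eq_bigr => /= i _.
have le_in : (i <= n)%N by rewrite -ltnS.
rewrite subSS Eq // rmorphM rmorphXn exprMn /=.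
have -> : y ^+ n = y ^+ (n - i) * y ^+ i by rewrite -exprD subnK.
transitivity (k l ^+ i * k p`_i * y ^+ (n - i) * (y * z) ^+ i).
  by rewrite yz expr1n mulr1.
by rewrite exprMn; ring.
Qed.
End Substitution.

(** * Isomorphisms that rescale or invert [y] *)

Section Isomorphisms.
Variable K : fieldType.
Implicit Types h g : {poly K}.

(** The value at [zA h] is determined as the inverse of the value at [yA h]. *)
Lemma A_ext h (R : comNzRingType) (u v : {rmorphism A h -> R}) :
  (forall c, u (kA h c) = v (kA h c)) -> u (x1 h) = v (x1 h) ->
  u (x2 h) = v (x2 h) -> u (yA h) = v (yA h) -> u =1 v.
Proof.
move=> Ec E1 E2 Ey; apply: A_ind => // [|a b Ea Eb|a b Ea Eb]; last 2 first.
- by rewrite !rmorphD Ea Eb.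
- by rewrite !rmorphM Ea Eb.
have uz : u (yA h) * u (zA h) = 1 by rewrite -rmorphM yzA rmorph1.
have vz : u (yA h) * v (zA h) = 1 by rewrite Ey -rmorphM yzA rmorph1.
by rewrite -[LHS]mulr1 -vz mulrA [u (zA h) * _]mulrC uz mul1r.
Qed.

Lemma AlgIso_of_inverse h g (phi : {rmorphism A h -> A g})
    (psi : {rmorphism A g -> A h}) :
  (forall c, phi (kA h c) = kA g c) -> (forall c, psi (kA g c) = kA h c) ->
  [/\ psi (phi (x1 h)) = x1 h, psi (phi (x2 h)) = x2 h & psi (phi (yA h)) = yA h] ->
  [/\ phi (psi (x1 g)) = x1 g, phi (psi (x2 g)) = x2 g & phi (psi (yA g)) = yA g] ->
  AlgIso h g.
Proof.
move=> phic psic [pf1 pf2 pfy] [fp1 fp2 fpy]; exists phi; split; last exact: phic.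
exists psi.
  by apply: (A_ext (u := psi \o phi) (v := idfun)) => //= c; rewrite phic psic.
by apply: (A_ext (u := phi \o psi) (v := idfun)) => //= c; rewrite psic phic.
Qed.

Lemma AlgIso_inv h g : AlgIso h g ->
  exists (phi : {rmorphism A h -> A g}) (psi : {rmorphism A g -> A h}),
  [/\ cancel phi psi, cancel psi phi, forall c, phi (kA h c) = kA g c
    & forall c, psi (kA g c) = kA h c].
Proof.
move=> [phi [[psi phiK psiK] phic]].
pose f1 := GRing.isZmodMorphism.Build _ _ psi (can2_zmod_morphism phiK psiK).
pose f2 := GRing.isMonoidMorphism.Build _ _ psi (can2_monoid_morphism phiK psiK).
pose psi' : {rmorphism A g -> A h} := HB.pack psi f1 f2.
exists phi, psi'; split=> // c.
by apply: (can_inj phiK); rewrite [LHS]psiK; apply/esym/phic.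
Qed.

Lemma AlgIso_trans h g f : AlgIso h g -> AlgIso g f -> AlgIso h f.
Proof.
move=> [u [bu uc]] [v [bv vc]]; exists (v \o u); split; first exact: bij_comp.
by move=> c /=; rewrite uc vc.
Qed.

(** The hypothesis reads [g(y) = c h(l y)], so [y] goes to [l y] and [x1] absorbs the scalar
    [1/c]. *)
Lemma scale_hom h g c l : c != 0 -> l != 0 ->
  (forall i, g`_i = c * l ^+ i * h`_i) ->
  exists phi : {rmorphism A h -> A g},
    [/\ forall d, phi (kA h d) = kA g d, phi (x1 h) = kA g c^-1 * x1 g,
        phi (x2 h) = x2 g & phi (yA h) = kA g l * yA g].
Proof.
move=> nzc nzl Eg.
have [||phi [Ec E1 E2 Ey _]] := @A_lift K h (A g) (@kA K g) (kA g c^-1 * x1 g)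
    (x2 g) (kA g l * yA g) (kA g l^-1 * zA g).
- rewrite -mulrA x1x2A.
  have := ev1_scale (@kA K g) (yA g) Eg; rewrite /ev1 /= /horner_eval => ->.
  by rewrite mulrA -rmorphM mulVf // rmorph1 mul1r.
- by rewrite mulrACA yzA mulr1 -rmorphM divff // rmorph1.
by exists phi.
Qed.

Lemma AlgIso_scale h g c l : c != 0 -> l != 0 ->
  (forall i, g`_i = c * l ^+ i * h`_i) -> AlgIso h g.
Proof.
move=> nzc nzl Eg; have [phi [Ec E1 E2 Ey]] := scale_hom nzc nzl Eg.
have nzc' := invr_neq0 nzc; have nzl' := invr_neq0 nzl.
have [|psi [Dc D1 D2 Dy]] := @scale_hom g h c^-1 l^-1 nzc' nzl'.
  move=> i; rewrite Eg mulrA (mulrACA c^-1) mulVf // mul1r.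
  by rewrite -exprMn mulVf // expr1n mul1r.
apply: (@AlgIso_of_inverse _ _ phi psi) => //; split.
- by rewrite E1 rmorphM Dc D1 mulrA -rmorphM invrK mulVf // rmorph1 mul1r.
- by rewrite E2 D2.
- by rewrite Ey rmorphM Dc Dy mulrA -rmorphM divff // rmorph1 mul1r.
- by rewrite D1 rmorphM Ec E1 mulrA -rmorphM invrK divff // rmorph1 mul1r.
- by rewrite D2 E2.
- by rewrite Dy rmorphM Ec Ey mulrA -rmorphM mulVf // rmorph1 mul1r.
Qed.

(** The hypothesis reads [g(y) = y^n h(1/y)], so [y] goes to [z] and [x1] absorbs the factor
    [z^n]. *)
Lemma flip_hom n h g : (size h <= n.+1)%N -> (size g <= n.+1)%N ->
  (forall i, (i <= n)%N -> g`_(n - i) = h`_i) ->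
  exists phi : {rmorphism A h -> A g},
    [/\ forall d, phi (kA h d) = kA g d, phi (x1 h) = zA g ^+ n * x1 g,
        phi (x2 h) = x2 g, phi (yA h) = zA g & phi (zA h) = yA g].
Proof.
move=> sh sg Eg.
have [||phi [Ec E1 E2 Ey Ez]] := @A_lift K h (A g) (@kA K g) (zA g ^+ n * x1 g)
    (x2 g) (zA g) (yA g).
- rewrite -mulrA x1x2A.
  have := @ev1_flip K _ (@kA K g) _ _ n 1 h g (yzA g) sh sg.
  rewrite /ev1 /= /horner_eval => ->; last by move=> i /Eg ->; rewrite expr1n mul1r.
  by rewrite rmorph1 mul1r mulrA -exprMn [zA g * _]mulrC yzA expr1n mul1r.
- by rewrite mulrC yzA.
by exists phi.
Qed.

Lemma AlgIso_flip n h g : (size h <= n.+1)%N -> (size g <= n.+1)%N ->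
  (forall i, (i <= n)%N -> g`_(n - i) = h`_i) -> AlgIso h g.
Proof.
move=> sh sg Eg; have [phi [Ec E1 E2 Ey Ez]] := flip_hom sh sg Eg.
have [|psi [Dc D1 D2 Dy Dz]] := @flip_hom n g h sg sh.
  by move=> i le_in; rewrite -Eg ?leq_subr // subKn.
apply: (@AlgIso_of_inverse _ _ phi psi) => //; split.
- by rewrite E1 rmorphM rmorphXn /= Dz D1 mulrA -exprMn yzA expr1n mul1r.
- by rewrite E2 D2.
- by rewrite Ey Dz.
- by rewrite D1 rmorphM rmorphXn /= Ez E1 mulrA -exprMn yzA expr1n mul1r.
- by rewrite D2 E2.
- by rewrite Dy Ez.
Qed.
End Isomorphisms.

(* The hypothesis is (i - N) * (j - M) = 1 over the integers. *)
Lemma mulz_sub_eq1 i j M N :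
  (j * N + M * i + 1 = j * i + M * N)%N -> i = N.+1 \/ N = i.+1.
Proof.
(* A number with two multiples that differ by [1] equals [1]; this is applied to the distance
   between [i] and [N]. *)
move=> E; have dvd1 a b d : (a * d + 1 = b * d)%N -> d = 1%N.
  move=> Ed; apply/eqP; rewrite -dvdn1.
  by rewrite -(dvdn_addr 1 (dvdn_mull a (dvdnn d))) Ed dvdn_mull.
have [le_iN|/ltnW le_Ni] := leqP i N.
  by right; have := @dvd1 j M (N - i)%N; rewrite !mulnBr; nia.
by left; have := @dvd1 M j (i - N)%N; rewrite !mulnBr; nia.
Qed.

(** * Constraints on an arbitrary isomorphism *)

Section Rigidity.
Variable K : fieldType.
Implicit Types h g : {poly K}.

Local Notation F := {fraction {poly {poly K}}}.

Lemma A_monomial_inj h a b m n :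
  a != 0 -> kA h a * yA h ^+ m = kA h b * yA h ^+ n -> m = n.
Proof.
move=> nza E; have [iota [Ec Ey _]] := embedding_exists h.
have /(congr1 iota) := E; rewrite !rmorphM !rmorphXn /= !Ec Ey.
rewrite /kF /YF /= -!tofracXn -!tofracM => /eqP; rewrite tofrac_eq => /eqP.
rewrite -!rmorphXn -!rmorphM /= => /polyC_inj/(congr1 (fun p : {poly K} => p`_m)).
rewrite !coefCM !coefXn eqxx mulr1; case: eqP => // _ /eqP.
by rewrite mulr0 (negbTE nza).
Qed.

Section Iso.
Variables (h g : {poly K}) (phi : {rmorphism A h -> A g}).
Variable psi : {rmorphism A g -> A h}.
Hypothesis phiK : cancel phi psi.
Hypotheses (phic : forall c, phi (kA h c) = kA g c).
Hypotheses (psic : forall c, psi (kA g c) = kA h c).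
Hypotheses (sh : (1 < size h)%N) (sg : (1 < size g)%N).
Hypotheses (h0 : h`_0 != 0) (g0 : g`_0 != 0).

(** Units go to units, so [phi] and [psi] send [y] to scalar multiples of [y^(i-N)] and [y^(j-M)].
    As [psi] undoes [phi], these exponents multiply to [1], and both are [1] or both are [-1]. *)
Lemma A_iso_y : exists c, c != 0 /\
  (phi (yA h) = kA g c * yA g \/ phi (yA h) = kA g c * zA g).
Proof.
have [|N [i [c [nzc Ey]]]] := @A_unit _ g (phi (yA h)) (phi (zA h)) sg g0.
  by rewrite -rmorphM yzA rmorph1.
have [|M [j [d [nzd Fy]]]] := @A_unit _ h (psi (yA g)) (psi (zA g)) sh h0.
  by rewrite -rmorphM yzA rmorph1.
have /(congr1 psi) := Ey; rewrite !rmorphM !rmorphXn /= phiK psic => E.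
(* The exponents of [y] on both sides of [E], after multiplication by [y^(M N + M i)] to use [Fy]
   without negative powers. *)
have Eexp : (j * N + M * i + 1 = j * i + M * N)%N.
  apply: (@A_monomial_inj h (d ^+ N) (c * d ^+ i)); first exact: expf_neq0.
  rewrite rmorphM !rmorphXn /=.
  transitivity ((kA h d * yA h ^+ j) ^+ N * yA h ^+ (M * i) * yA h).
    by rewrite !exprMn !exprD -exprM expr1; ring.
  transitivity (kA h c * (kA h d * yA h ^+ j) ^+ i * yA h ^+ (M * N)); last first.
    by rewrite !exprMn !exprD -exprM; ring.
  rewrite -Fy !exprMn -!exprM.
  transitivity (yA h ^+ (M * N) * yA h ^+ (M * i) * (psi (yA g) ^+ N * yA h)).
    by ring.
  by rewrite E; ring.
have yz n : zA g ^+ n * yA g ^+ n = 1.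
  by rewrite -exprMn [_ * yA g]mulrC yzA expr1n.
exists c; split=> //; case: (mulz_sub_eq1 Eexp) => EN.
- left; have /(congr1 (fun u => zA g ^+ N * u)) := Ey.
  by rewrite mulrA yz mul1r mulrCA EN exprSr (mulrA (zA g ^+ N)) yz mul1r.
- right; have /(congr1 (fun u => zA g ^+ N * u)) := Ey.
  by rewrite mulrA yz mul1r mulrCA EN exprS -mulrA yz mulr1.
Qed.

(* phi x1 is not a function of y: the torus x1 -> t x1 moves x1 but fixes the
   subalgebra K[y^+-1], which psi preserves. *)
Lemma A_iso_x1 N p : yA g ^+ N * phi (x1 h) <> ev1 (@kA K g) (yA g) p.
Proof.
move=> /(congr1 psi); rewrite rmorphM rmorphXn /= phiK.
rewrite (rmorph_ev1 _ _ psic) => E.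
have [u [uc uy u1]] := A_torus_point h (TF_neq0 K).
have nzT2 : TF K ^+ 2 != 0 by rewrite expf_neq0 ?TF_neq0.
have [v [vc vy v1]] := A_torus_point h nzT2.
have [c [nzc Ey]] := A_iso_y.
(* [psi (yA g)] is a scalar multiple of [yA h] or of its inverse, and [u] and [v] agree on those. *)
have uv : u (psi (yA g)) = v (psi (yA g)).
  have uvz : u (zA h) = v (zA h).
    apply: (mulfI (YF_neq0 K)).
    by rewrite -{1}uy -{1}vy -(rmorphM u) -(rmorphM v) yzA !rmorph1.
  have nzc' : kF c != 0 by rewrite fmorph_eq0.
  case: Ey => /(congr1 psi); rewrite phiK (rmorphM psi) /= psic => Ey.
    apply: (mulfI nzc'); rewrite -{1}uc -{1}vc -(rmorphM u) -(rmorphM v) -Ey.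
    by rewrite uy vy.
  have Ez : psi (yA g) * yA h = kA h c.
    by rewrite Ey mulrCA -(rmorphM psi) yzA rmorph1 mulr1.
  apply: (mulIf (YF_neq0 K)).
  by rewrite -{1}uy -vy -(rmorphM u) -(rmorphM v) Ez uc vc.
have nzu : v (psi (yA g)) != 0.
  apply/eqP => v0; have /(congr1 (fun a => v (psi a)))/eqP := yzA g.
  by rewrite !rmorphM !rmorph1 v0 mul0r eq_sym oner_eq0.
(* The right-hand sides coincide under [u] and [v]; cancelling the nonzero factor leaves
   [TF = TF^2], which is absurd. *)
have := congr1 u E; have := congr1 v E.
rewrite !rmorphM !rmorphXn /= u1 v1 (rmorph_ev1 _ _ uc) (rmorph_ev1 _ _ vc) uv => <-.
move/(mulfI (expf_neq0 N nzu))/eqP; rewrite -tofracXn tofrac_eq => /eqP.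
move/(congr1 (fun P : {poly {poly K}} => P`_1)).
by rewrite coefX coefXn => /eqP; rewrite oner_eq0.
Qed.

(** The images of [x1] and [x2] are adapted factors of a monomial in [TF]. The alternative to
    divisibility would make [phi (x1 h)], times a power of [y], a polynomial in [y], which
    [A_iso_x1] excludes. *)
Lemma A_iso_dvdp e r : r != 0 ->
  yA g ^+ e * (phi (x1 h) * phi (x2 h)) = ev1 (@kA K g) (yA g) r -> g %| r.
Proof.
move=> nzr E; have nzg : g != 0 by rewrite -size_poly_gt0 ltnW.
have [iota Hi] := embedding_exists g; have [Ec Ey _] := Hi.
have [N [n [P [aP EP _]]]] := A_image (phi (x1 h)) nzg Hi.
have [M [m [Q [aQ EQ _]]]] := A_image (phi (x2 h)) nzg Hi.
have PQ : P * (('X^e)%:P * Q) = ('X^(N + M) * r)%:P * 'X^(n + m).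
  apply/eqP; rewrite -tofrac_eq !rmorphM /= -EP -EQ -(ev1F r) -Ey.
  rewrite -(rmorph_ev1 _ _ Ec) -E !rmorphM !rmorphXn /= !exprD !Ey; apply/eqP.
  by rewrite -/(TF K) -/(YF K); ring.
have nzXr : 'X^(N + M) * r != 0 by rewrite mulf_neq0 ?expf_neq0 ?polyX_eq0.
have [[p Ep]|] := adapted_mul_monomial aP (adapted_mulC _ aQ) nzXr PQ; last first.
  by rewrite dvdp_mulXn.
case: (@A_iso_x1 N p); apply: (embedding_inj nzg Hi).
rewrite rmorphM rmorphXn /= (rmorph_ev1 _ _ Ec) Ey ev1F.
apply: (mulIf (expf_neq0 n (TF_neq0 K))).
by rewrite mulrAC EP Ep rmorphM rmorphXn.
Qed.

(** The two polynomials are [h(c y)] and [y^s h(c/y)], that is, the image of [x1 x2] with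
    denominators cleared. The term [h(0)] keeps them nonzero. *)
Lemma A_iso_poly s : (size h <= s.+1)%N -> exists c, c != 0 /\
  (g %| \poly_(i < s.+1) (c ^+ i * h`_i) \/
   g %| \poly_(i < s.+1) (c ^+ (s - i) * h`_(s - i))).
Proof.
move=> shs; have [c [nzc Ey]] := A_iso_y; exists c; split=> //.
have Ex : phi (x1 h) * phi (x2 h) = ev1 (@kA K g) (phi (yA h)) h.
  by rewrite -rmorphM x1x2A -(rmorph_ev1 _ _ phic).
case: Ey => Ey; [left; apply: (@A_iso_dvdp 0)|right; apply: (@A_iso_dvdp s)].
- apply/eqP => /(congr1 (fun p : {poly K} => p`_0))/eqP.
  by rewrite coef_poly coef0 /= expr0 mul1r (negbTE h0).
- rewrite expr0 mul1r Ex Ey [RHS](@ev1_scale _ _ _ _ 1 c h).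
    by rewrite rmorph1 mul1r.
  move=> i; rewrite coef_poly mul1r; case: ltnP => // le_si.
  by rewrite nth_default ?mulr0 // (leq_trans shs).
- apply/eqP => /(congr1 (fun p : {poly K} => p`_s))/eqP.
  by rewrite coef_poly coef0 ltnSn subnn expr0 mul1r (negbTE h0).
- rewrite Ex Ey; apply/esym/(ev1_flip _ (yzA g) shs (size_poly _ _)).
  by move=> i le_is; rewrite coef_poly ltnS leq_subr subKn.
Qed.
End Iso.
End Rigidity.

(** * The normal form [fb b] and the dihedral action on its coefficients *)

Section Normalization.
Variables (K : fieldType) (s : nat).
Hypothesis s_gt0 : (0 < s)%N.
Implicit Types b : 'rV[K]_(s.-1).

(** With both ends tested first, [insub] fails only for [j > s]. *)
Lemma coef_fb b j : (fb b)`_j =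
  if (j == 0%N) || (j == s) then 1
  else if insub j.-1 is Some i then b 0 i else 0.
Proof.
rewrite /fb !coefD coefXn coef1 coef_sum.
have [->|nzj] := eqVneq j 0%N.
  rewrite big1 ?addr0 => [|i _]; last by rewrite coefZ coefXn mulr0.
  by rewrite (ltn_eqF s_gt0) add0r.
rewrite addr0 /=; have [->|nej] := eqVneq j s.
  rewrite big1 ?addr0 // => i _; have := ltn_ord i; rewrite coefZ coefXn.
  by case: eqP => [|_ _]; [lia|rewrite mulr0].
rewrite add0r; case: insubP => [i _ Ei|].
  rewrite (bigD1 i) //= coefZ coefXn Ei prednK ?lt0n // eqxx mulr1.
  rewrite big1 ?addr0 // => l /eqP nli; rewrite coefZ coefXn.
  case: eqP => [Ej|_]; last by rewrite mulr0.
  by case: nli; apply/val_inj; rewrite /= Ei Ej.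
move=> Hj; rewrite big1 // => i _; have := ltn_ord i; rewrite coefZ coefXn.
by case: eqP => [Ej|_ _]; [move: Hj; rewrite Ej /= => /negbTE->|rewrite mulr0].
Qed.

Lemma coef_fb0 b : (fb b)`_0 = 1.
Proof. by rewrite coef_fb eqxx. Qed.

Lemma coef_fbs b : (fb b)`_s = 1.
Proof. by rewrite coef_fb eqxx orbT. Qed.

Lemma coef_fbS b (i : 'I_s.-1) : (fb b)`_i.+1 = b 0 i.
Proof.
have lt_i := ltn_ord i; rewrite coef_fb /= valK.
by rewrite (_ : i.+1 == s = false) //; apply/eqP; lia.
Qed.

Lemma size_fb b : size (fb b) = s.+1.
Proof.
apply/eqP; rewrite eqn_leq; apply/andP; split.
  apply/leq_sizeP => j lt_sj; rewrite coef_fb.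
  rewrite (_ : (j == 0%N) || (j == s) = false); last by lia.
  by rewrite insubF //; lia.
by rewrite ltnNge; apply/negP => /(nth_default 0)/eqP; rewrite coef_fbs oner_eq0.
Qed.

Variant coef_fb_index : nat -> Prop :=
  | CoefFb0 : coef_fb_index 0
  | CoefFbS (i : 'I_s.-1) : coef_fb_index i.+1
  | CoefFbs : coef_fb_index s.

Lemma coef_fb_indexP j : (j <= s)%N -> coef_fb_index j.
Proof.
case: j => [|j] lt_js; first by constructor.
have [->|nej] := eqVneq j.+1 s; first by constructor.
have lt_j : (j < s.-1)%N by lia.
exact: (CoefFbS (Ordinal lt_j)).
Qed.

Lemma fb_uniq (p : {poly K}) b : (size p <= s.+1)%N -> p`_0 = 1 -> p`_s = 1 ->
  (forall i : 'I_s.-1, p`_i.+1 = b 0 i) -> p = fb b.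
Proof.
move=> sp p0 ps pS; apply/polyP => j; have [le_js|lt_sj] := leqP j s.
  case: (coef_fb_indexP le_js) => [|i|].
  - by rewrite p0 coef_fb0.
  - by rewrite pS coef_fbS.
  - by rewrite ps coef_fbs.
by rewrite !nth_default ?size_fb // (leq_trans sp).
Qed.

Lemma fb_inj : injective (@fb K s).
Proof. by move=> b b' E; apply/rowP => i; rewrite -!coef_fbS E. Qed.

(** The factor [1] matches the coefficient hypothesis of [AlgIso_scale]. *)
Lemma fb_act_mu zeta b i :
  zeta ^+ s = 1 -> (fb (act_mu zeta b))`_i = 1 * zeta ^+ i * (fb b)`_i.
Proof.
move=> zs; rewrite mul1r; have [le_is|lt_si] := leqP i s; last first.
  by rewrite !nth_default ?size_fb // mulr0.
case: (coef_fb_indexP le_is) => [|j|].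
- by rewrite !coef_fb0 mulr1.
- by rewrite !coef_fbS mxE.
- by rewrite !coef_fbs zs mulr1.
Qed.

Lemma fb_act_r b i : (i <= s)%N -> (fb (act_r b))`_(s - i) = (fb b)`_i.
Proof.
move=> le_is; case: (coef_fb_indexP le_is) => [|j|].
- by rewrite subn0 coef_fbs coef_fb0.
- have lt_j := ltn_ord j; rewrite coef_fbS -[RHS]/(b 0 j).
  have -> : (s - j.+1 = (rev_ord j).+1)%N by rewrite /=; lia.
  by rewrite coef_fbS mxE rev_ordK.
- by rewrite subnn coef_fbs coef_fb0.
Qed.

(** Roots of unity act by rescaling [y], the involution by inverting [y]. *)
Lemma same_orbit_AlgIso b b' : same_orbit b b' -> AlgIso (fb b) (fb b').
Proof.
elim=> {b b'} [b b' [[zeta [zs ->]]| ->]|b|b1 b2 b3 _ I12 _ I23].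
- have nzz : zeta != 0.
    by apply/eqP => z0; move/eqP: zs; rewrite z0 expr0n gtn_eqF // eq_sym oner_eq0.
  by apply: (AlgIso_scale (oner_neq0 K) nzz) => i; apply: fb_act_mu.
- by apply: (@AlgIso_flip K s); rewrite ?size_fb // => i; apply: fb_act_r.
- apply: (AlgIso_scale (oner_neq0 K) (oner_neq0 K)) => i.
  by rewrite expr1n !mul1r.
- exact: AlgIso_trans I12 I23.
Qed.

(** The degree of [r] is at most that of its divisor, so the quotient is a scalar, read off at the
    constant term since [fb b] has value [1] at [0]. *)
Lemma dvdp_fb (r : {poly K}) b : r`_0 != 0 -> (size r <= s.+1)%N -> fb b %| r ->
  r = r`_0 *: fb b.
Proof.
move=> nz0 sr dvd_r; have nzr : r != 0 by apply: contraNneq nz0 => ->; rewrite coef0.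
have : fb b %= r.
  by rewrite -dvdp_size_eqp // eqn_leq dvdp_leq // size_fb.
case/eqpP=> -[a d] /= /andP[nza nzd] E.
have Er : r = (d^-1 * a) *: fb b.
  by rewrite -scalerA E scalerA mulVf // scale1r.
by rewrite [in RHS]Er coefZ coef_fb0 mulr1.
Qed.

(** Divisibility becomes proportionality. The end coefficients of both normal forms are [1], which
    forces [c^s = 1]; then [b'] is [act_mu c b] or its reversal. *)
Lemma AlgIso_same_orbit b b' : AlgIso (fb b) (fb b') -> same_orbit b b'.
Proof.
move=> /AlgIso_inv [phi [psi [phiK _ phic psic]]].
have sb b0 : (1 < size (fb b0))%N by rewrite size_fb.
have nz b0 : (fb b0)`_0 != 0 by rewrite coef_fb0 oner_eq0.
have [|c [nzc]] := A_iso_poly phiK phic psic (sb b) (sb b') (nz b) (nz b') (s := s).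
  by rewrite size_fb.
have step zeta b1 b2 : zeta ^+ s = 1 -> b2 = act_mu zeta b1 -> same_orbit b1 b2.
  by move=> zs ->; apply: rt_step; left; exists zeta.
case=> /dvdp_fb; rewrite ?size_poly !coef_poly /= ?expr0 ?subn0.
- rewrite mul1r coef_fb0 oner_eq0 scale1r => /(_ isT isT) E.
  have cs : c ^+ s = 1.
    have := congr1 (fun p : {poly K} => p`_s) E.
    by rewrite coef_poly ltnSn !coef_fbs mulr1.
  apply: (step c) => //; apply: fb_inj; apply/polyP => i.
  rewrite -E coef_poly fb_act_mu // mul1r; case: ltnP => // lt_si.
  by rewrite nth_default ?mulr0 ?size_fb.
(* In the reversed case the proportionality factor is [c^s], while the coefficient of degree [s] is
   [h(0) = 1]. *)
- rewrite coef_fbs mulr1 expf_neq0 // => /(_ isT isT) E.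
  have cs : c ^+ s = 1.
    have := congr1 (fun p : {poly K} => p`_s) E.
    by rewrite coef_poly ltnSn subnn coefZ coef_fb0 coef_fbs !mulr1.
  apply: (@rt_trans _ _ _ (act_mu c b)); first exact: (step c).
  apply: rt_step; right; apply: fb_inj; apply/polyP => i.
  move: E; rewrite cs scale1r => <-; rewrite coef_poly.
  case: ltnP => [le_is|lt_si]; last by rewrite nth_default ?size_fb.
  have := fb_act_r (act_mu c b) (leq_subr i s).
  by rewrite subKn // => ->; rewrite fb_act_mu // mul1r.
Qed.
End Normalization.

(** * Orbits and isomorphism classes *)

Theorem theorem3p8 (K : closedFieldType) (charK0 : [pchar K] =i pred0)
    (s : nat) (s_ge1 : (1 <= s)%N) :
  (* surjectivity: every A_f with deg f = s, f(0) <> 0, is some A_{f_b} *)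
  (forall f : {poly K}, size f = s.+1 -> f`_0 != 0 ->
     exists b : 'rV[K]_(s.-1), AlgIso f (fb b))
  /\
  (* well-definedness and injectivity on D_{2s}-orbits *)
  (forall b b' : 'rV[K]_(s.-1), AlgIso (fb b) (fb b') <-> same_orbit b b').
Proof.
split=> [f sf nzf0|b b']; last first.
  by split; [apply: AlgIso_same_orbit|apply: same_orbit_AlgIso].
have nzfs : f`_s != 0.
  by have := lead_coef_eq0 f; rewrite lead_coefE sf -size_poly_eq0 sf /= => ->.
(* Replacing [f(y)] by [f(l y) / f(0)] makes the constant term [1]; the leading coefficient becomes
   [1] exactly for this value of [l^s]. *)
have [l El] : exists l, l ^+ s = f`_0 / f`_s.
  have [l] := solve_monicpoly (fun i => if i == 0%N then f`_0 / f`_s else 0) s_ge1.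
  move=> El; exists l; rewrite El (bigD1 (Ordinal s_ge1)) //=.
  rewrite expr0 mulr1 big1 ?addr0 // => i.
  by rewrite -val_eqE /= => /negbTE ->; rewrite mul0r.
have nzl : l != 0.
  apply/eqP => l0; move/eqP: El; rewrite l0 expr0n gtn_eqF // eq_sym.
  by rewrite mulf_eq0 invr_eq0 (negbTE nzf0) (negbTE nzfs).
pose b : 'rV[K]_(s.-1) := \row_i ((f`_0)^-1 * l ^+ i.+1 * f`_i.+1).
exists b; apply: (AlgIso_scale (invr_neq0 nzf0) nzl).
pose p := \poly_(i < s.+1) ((f`_0)^-1 * l ^+ i * f`_i).
have <- : p = fb b.
  apply: fb_uniq => //; first exact: size_poly.
  - by rewrite coef_poly expr0 mulr1 mulVf.
  - by rewrite coef_poly ltnSn El mulrA mulVf // mul1r mulVf.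
  - by move=> i; rewrite coef_poly mxE ifT //; have := ltn_ord i; lia.
move=> i; rewrite coef_poly; case: ltnP => // le_si.
by rewrite [f`_i]nth_default ?mulr0 ?sf.
Qed.
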